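(* Let $R$ be a ring with only trivial idempotents (that is, the only idempotents of $R$ are $0$ and $1$). Then $R$ is strongly NUS-nil clean if and only if $R$ is a local ring with $J(R)$ nil.
   Context: All rings are associative with identity $1\neq 0$, not necessarily commutative. $J(R)$ denotes the Jacobson radical of $R$; it is nil if all of its elements are nilpotent. A ring is local if its non-invertible elements form a two-sided ideal (equivalently, it has a unique maximal left ideal). An element $e\in R$ is square-idempotent if $e^2=e^4$. An element $a\in R$ is strongly square-nil clean if $a=e+n$ with $e\in R$ square-idempotent, $n\in R$ nilpotent and $en=ne$. A ring $R$ is strongly NUS-nil clean if every non-invertible element of $R$ is strongly square-nil clean. *)

(* Defs.v *)
From HB Require Import structures.
From mathcomp Require Import all_boot all_algebra.
From mathcomp Require Import boolp classical_sets.

Set Implicit Arguments.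
Unset Strict Implicit.
Unset Printing Implicit Defensive.

Import GRing.Theory.

Local Open Scope classical_set_scope.
Local Open Scope ring_scope.

Section RingNotions.
Variable R : nzRingType.
Implicit Types (a e n x : R) (I K : set R).

(* [GRing.unit] would require a [unitRingType], i.e. extra structure on [R]. *)
Definition invertible x : Prop := exists y, x * y = 1 /\ y * x = 1.

Definition nilpotent_elt x : Prop := exists k : nat, x ^+ k = 0.

Definition idempotent_elt e : Prop := e * e = e.

Definition square_idempotent e : Prop := e ^+ 2 = e ^+ 4.

Definition only_trivial_idempotents : Prop :=
  forall e, idempotent_elt e -> e = 0 \/ e = 1.

Definition strongly_square_nil_clean a : Prop :=
  exists e n, [/\ square_idempotent e, nilpotent_elt n, GRing.comm e n
                & a = e + n].

Definition strongly_NUS_nil_clean : Prop :=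
  forall a, ~ invertible a -> strongly_square_nil_clean a.

Definition left_ideal I : Prop :=
  [/\ I 0, forall x y, I x -> I y -> I (x - y) & forall r x, I x -> I (r * x)].

Definition two_sided_ideal I : Prop :=
  left_ideal I /\ forall x r, I x -> I (x * r).

Definition maximal_left_ideal I : Prop :=
  [/\ left_ideal I, I <> setT
    & forall K, left_ideal K -> I `<=` K -> K = I \/ K = setT].

Definition jacobson_radical : set R :=
  \bigcap_(I in [set I | maximal_left_ideal I]) I.

Definition nil_set I : Prop := forall x, I x -> nilpotent_elt x.

Definition local_ring : Prop := two_sided_ideal [set x | ~ invertible x].

End RingNotions.

Arguments jacobson_radical R : clear implicits.

(* Main.v *)
Require Import Defs.
From mathcomp Require Import all_boot all_algebra.
From mathcomp Require Import boolp classical_sets.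

(** When the only idempotents are [0] and [1], both sides of the equivalence say
    that every non-invertible element is nilpotent.

    If [e ^+ 2 = e ^+ 4] then [e ^+ 2] is idempotent, so it is [0] or [1].
    When [a = e + n] is a strongly square-nil clean decomposition, the case
    [e ^+ 2 = 1] makes [a] a unit plus a commuting nilpotent, hence invertible,
    and the case [e ^+ 2 = 0] makes [a] a sum of two commuting nilpotents, hence
    nilpotent ([square_nil_clean_unit_or_nilpotent]).  Thus the strongly NUS-nil
    clean condition forces non-invertible elements to be nilpotent; conversely a
    nilpotent [a] decomposes as [0 + a].

    A ring in which all non-invertible elements are nilpotent is local
    ([nilpotent_nonunits_local]), because a nilpotent element has no one-sided
    inverse and [1 + m] is invertible for [m] nilpotent.  Finally, in a local
    ring the non-invertible elements form the unique maximal left ideal, so they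
    are exactly the Jacobson radical ([local_jacobson_radical]), and saying that
    the radical is nil is saying that non-invertible elements are nilpotent. *)

Set Implicit Arguments.
Unset Strict Implicit.
Unset Printing Implicit Defensive.

Import GRing.Theory.

Local Open Scope classical_set_scope.
Local Open Scope ring_scope.

Section NilpotentNonunits.
Variable R : nzRingType.
Implicit Types (a e m n u x y : R) (I : set R).

Lemma invertible1 : invertible (1 : R).
Proof. by exists 1; rewrite mulr1. Qed.

Lemma invertibleM x y : invertible x -> invertible y -> invertible (x * y).
Proof.
move=> [x' [xx' x'x]] [y' [yy' y'y]]; exists (y' * x'); split.
- by rewrite mulrA -(mulrA x) yy' mulr1.
- by rewrite mulrA -(mulrA y') x'x mulr1.
Qed.

(** The inverse is the geometric series in [- m]: it is a finite sum, and it
    commutes with [m]. *)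
Lemma invertible_1Dnilpotent m : nilpotent_elt m -> invertible (1 + m).
Proof.
move=> [k mk0]; pose S := \sum_(i < k) (- m) ^+ i.
have S_inv : (1 + m) * S = 1.
  have := subrX1 (- m) k.
  by rewrite exprNn mk0 mulr0 sub0r -opprD mulNr addrC => /oppr_inj.
have S_comm : GRing.comm (1 + m) S.
  apply: commr_sum => i _; apply/commrX/commrN/commr_sym/commrD => //.
  exact: commr1.
by exists S; split; rewrite // -S_comm.
Qed.

Lemma nilpotent_commM x n :
  GRing.comm x n -> nilpotent_elt n -> nilpotent_elt (x * n).
Proof. by move=> xn [k nk0]; exists k; rewrite exprMn_comm // nk0 mulr0. Qed.

Lemma nilpotent_no_left_inverse x y : nilpotent_elt x -> y * x <> 1.
Proof.
move=> [k xk0] yx1.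
have yxk i : y ^+ i * x ^+ i = 1.
  elim: i => [|i IHi]; first by rewrite !expr0 mulr1.
  by rewrite exprSr exprS mulrA -(mulrA _ y) yx1 mulr1.
by have := oner_neq0 R; rewrite -(yxk k) xk0 mulr0 eqxx.
Qed.

Lemma nilpotent_no_right_inverse x y : nilpotent_elt x -> x * y <> 1.
Proof.
move=> [k xk0] xy1.
have xyk i : x ^+ i * y ^+ i = 1.
  elim: i => [|i IHi]; first by rewrite !expr0 mulr1.
  by rewrite exprSr exprS mulrA -(mulrA _ x) xy1 mulr1.
by have := oner_neq0 R; rewrite -(xyk k) xk0 mul0r eqxx.
Qed.

(** With [e ^+ 2 = 1], factor [e + n = e * (1 + e * n)]; with [e ^+ 2 = 0], the
    square [(e + n) ^+ 2 = (e + e + n) * n] is a multiple of [n] by an element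
    commuting with it. *)
Lemma square_nil_clean_unit_or_nilpotent a :
  only_trivial_idempotents R -> strongly_square_nil_clean a ->
  invertible a \/ nilpotent_elt a.
Proof.
move=> trivR [e [n [e2e4 n_nil en ->]]].
have e2_idem : idempotent_elt (e ^+ 2) by rewrite /idempotent_elt -exprD -e2e4.
have [e20|e21] := trivR _ e2_idem; last first.
  left; have -> : e + n = e * (1 + e * n).
    by rewrite mulrDr mulr1 mulrA -expr2 e21 mul1r.
  apply: invertibleM; first by exists e; rewrite -expr2.
  exact/invertible_1Dnilpotent/nilpotent_commM.
right; have [k sqk0] : nilpotent_elt ((e + n) ^+ 2).
  have -> : (e + n) ^+ 2 = (e + e + n) * n.
    by rewrite expr2 mulrDr !mulrDl -expr2 e20 add0r en addrA.
  apply: nilpotent_commM => //; apply/commr_sym/commrD => //.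
  by apply: commrD; apply: commr_sym.
by exists (2 * k)%N; rewrite exprM.
Qed.

(** Multiples of a nilpotent are non-invertible, since a nilpotent has no
    one-sided inverse.  If a difference [u = x - y] of non-units had an inverse
    [v], then [v * x = 1 + v * y] would be both a non-unit and a unit. *)
Lemma nilpotent_nonunits_local :
  (forall x, ~ invertible x -> nilpotent_elt x) -> local_ring R.
Proof.
move=> nilN.
have nonunitMl r x : ~ invertible x -> ~ invertible (r * x).
  move=> /nilN xnil [z [_ zrx]].
  by apply: (nilpotent_no_left_inverse (y := z * r) xnil); rewrite -mulrA.
have nonunitMr r x : ~ invertible x -> ~ invertible (x * r).
  move=> /nilN xnil [z [xrz _]].
  by apply: (nilpotent_no_right_inverse (y := r * z) xnil); rewrite mulrA.
split; last by move=> x r; exact: nonunitMr.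
split; last by move=> r x; exact: nonunitMl.
- by move=> [z []] /eqP; rewrite mul0r eq_sym oner_eq0.
- move=> x y Nx Ny [v [_ vxy]]; apply: (nonunitMl v x Nx).
  have -> : v * x = 1 + v * y by rewrite -vxy mulrBr subrK.
  exact/invertible_1Dnilpotent/nilN/nonunitMl.
Qed.

Lemma left_ideal_unit I u : left_ideal I -> invertible u -> I u -> I = setT.
Proof.
move=> [_ _ IM] [v [_ vu]] Iu; apply/seteqP; split=> // x _.
by rewrite -(mulr1 x) -vu mulrA; apply: IM.
Qed.

(** A proper left ideal contains no unit, so it lies inside the set of
    non-units; when that set is itself a left ideal, it is the only maximal
    one. *)
Lemma local_maximal_left_ideal I :
  local_ring R -> maximal_left_ideal I <-> I = [set x | ~ invertible x].
Proof.
move=> [idN _].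
have proper_sub (K : set R) :
    left_ideal K -> K <> setT -> K `<=` [set x | ~ invertible x].
  by move=> idK KT x Kx ux; apply: KT; exact: left_ideal_unit idK ux Kx.
have NT : [set x : R | ~ invertible x] <> setT.
  move=> NT; have : [set: R] 1 by [].
  by rewrite -NT; apply; exact: invertible1.
split=> [[idI IT maxI]|->].
  by have [|//] := maxI _ idN (proper_sub I idI IT).
split=> // K idK NK; have [->|KT] := EM (K = setT); first by right.
by left; apply/seteqP; split => //; exact: proper_sub.
Qed.

Lemma local_jacobson_radical :
  local_ring R -> jacobson_radical R = [set x | ~ invertible x].
Proof.
move=> locR; apply/seteqP; split=> x.
  by apply; apply/local_maximal_left_ideal.
by move=> Nx I /(local_maximal_left_ideal _ locR) ->.
Qed.

End NilpotentNonunits.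

Theorem corollary2p24 (R : nzRingType) (hR : only_trivial_idempotents R) :
  strongly_NUS_nil_clean R <-> (local_ring R /\ nil_set (jacobson_radical R)).
Proof.
split=> [cleanR|[locR]].
  have nilN (x : R) : ~ invertible x -> nilpotent_elt x.
    move=> Nx.
    by have [] := square_nil_clean_unit_or_nilpotent hR (cleanR x Nx).
  have locR := nilpotent_nonunits_local nilN.
  by split; rewrite // local_jacobson_radical.
rewrite local_jacobson_radical // => nilN a Na.
exists 0, a; split; last by rewrite add0r.
- by rewrite /square_idempotent !expr0n.
- exact: nilN.
- exact/commr_sym/commr0.
Qed.
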